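(* Let $\mathcal{A}$ be any first-order structure with universe $U_{\mathcal{A}}$ and let $Q=U_{\mathcal{A}}^\infty$. Then $(\mathrm{SDEC}_{\mathcal{A}}^\nu)^Q=\mathrm{SDEC}_{\mathcal{A}}^{\mathrm{ND}}$.
   Context: A first-order structure $\mathcal{A}=(U_{\mathcal{A}};(c_i)_{i};(f_i)_{i};(r_i)_{i})$ has a universe, constants, functions $f_i$ of arity $m_i$ and relations $r_i$ of arity $k_i$ (the identity relation need not be among them). $U_{\mathcal{A}}^\infty=\bigcup_{n\ge1}U_{\mathcal{A}}^n$. A (deterministic) BSS RAM $\mathcal{M}$ over $\mathcal{A}$ has $Z$-registers $Z_1,Z_2,\dots$ (holding elements of $U_{\mathcal{A}}$), finitely many index registers $I_1,\dots,I_{k}$ (holding positive integers), and a program: a finite sequence of labeled instructions $1,\dots,\ell_{\mathcal P}$, the last being the only stop instruction, each of one of the types: $Z_j:=f_i(Z_{j_1},\dots,Z_{j_{m_i}})$; $Z_j:=c_i$; $Z_{I_j}:=Z_{I_k}$; if $r_i(Z_{j_1},\dots,Z_{j_{k_i}})$ then goto $\ell_1$ else goto $\ell_2$; if $I_j=I_k$ then goto $\ell_1$ else goto $\ell_2$; $I_j:=1$; $I_j:=I_j+1$; stop. A configuration is $(\ell,\nu_1,\dots,\nu_k,u_1,u_2,\dots)$, transformed step by step in the obvious way. On input $\vec x=(x_1,\dots,x_n)$ the initial configuration is $(1,(n,1,\dots,1),(x_1,\dots,x_n,x_n,x_n,\dots))$; at the stop label the output is $(u_1,\dots,u_{\nu_1})$.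 The halting set of a machine is the set of inputs with at least one halting computation. A non-deterministic BSS RAM over $\mathcal{A}$ is like a deterministic one except that on input $\vec x$ every configuration $(1,(n,1,\dots,1),(x_1,\dots,x_n,y_1,\dots,y_m,x_n,x_n,\dots))$ with $m\ge1$ and arbitrary guesses $(y_1,\dots,y_m)\in U_{\mathcal{A}}^m$ is an admissible initial configuration. $\mathrm{SDEC}_{\mathcal{A}}^{\mathrm{ND}}$ is the class of halting sets of such machines. For $Q\subseteq U_{\mathcal{A}}^\infty$ and $\vec z\in U_{\mathcal{A}}^\infty$, $\nu[Q](\vec z)=\{y_1\in U_{\mathcal{A}}\mid \exists m\ge1\ \exists y_2,\dots,y_m:\ (\vec z,y_1,\dots,y_m)\in Q\}$. A $\nu$-oracle BSS RAM over $\mathcal{A}$ with oracle $Q$ is a BSS RAM (deterministic input procedure) that may additionally use instructions $Z_j:=\nu[Q](Z_1,\dots,Z_{I_1})$, which set $Z_j$ to an arbitrarily chosen element of $\nu[Q](u_1,\dots,u_{\nu_1})$ (current contents of $Z_1,\dots,Z_{\nu_1}$, $\nu_1$ the content of $I_1$), and loop forever if this set is empty. $(\mathrm{SDEC}_{\mathcal{A}}^\nu)^Q$ is the class of halting sets of $\nu$-oracle BSS RAMs over $\mathcal{A}$ with oracle $Q$. *)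

(* Defs.v *)
From Stdlib Require Import List Arith PeanoNat.
From Stdlib Require Fin.
Import ListNotations.
Set Implicit Arguments.

(** * First-order structures
    A structure has a universe [U], a family of constants, a family of
    functions (with arities) and a family of relations (with arities).
    Arguments of an arity-[m] function/relation are given as a map
    [Fin.t m -> U]. The identity relation is not required to be present. *)
Record structure : Type := {
  U : Type;
  cidx : Type;
  cst : cidx -> U;
  fidx : Type;
  farity : fidx -> nat;
  fn : forall i : fidx, (Fin.t (farity i) -> U) -> U;
  ridx : Type;
  rarity : ridx -> nat;
  rel : forall i : ridx, (Fin.t (rarity i) -> U) -> Prop
}.

(** Elements of U^infty are the non-empty lists over U. *)

(** * Instructions (register numbers and labels are 1-based, as in the paper)
  - [IFun j i args]     : Z_j := f_i(Z_{args 1}, ..., Z_{args m_i})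
  - [IConst j i]        : Z_j := c_i
  - [ICopy j k]         : Z_{I_j} := Z_{I_k}
  - [IRel i args l1 l2] : if r_i(Z_{args ..}) then goto l1 else goto l2
  - [IIdxEq j k l1 l2]  : if I_j = I_k then goto l1 else goto l2
  - [IIdxSet1 j]        : I_j := 1
  - [IIdxInc j]         : I_j := I_j + 1
  - [IStop]             : stop
  - [IOracle j]         : Z_j := nu[Q](Z_1, ..., Z_{I_1})   (oracle machines only) *)
Inductive instr (A : structure) : Type :=
| IFun (j : nat) (i : fidx A) (args : Fin.t (farity A i) -> nat)
| IConst (j : nat) (i : cidx A)
| ICopy (j k : nat)
| IRel (i : ridx A) (args : Fin.t (rarity A i) -> nat) (l1 l2 : nat)
| IIdxEq (j k l1 l2 : nat)
| IIdxSet1 (j : nat)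
| IIdxInc (j : nat)
| IStop
| IOracle (j : nat).

Arguments IFun {A}. Arguments IConst {A}. Arguments ICopy {A}. Arguments IRel {A}.
Arguments IIdxEq {A}. Arguments IIdxSet1 {A}. Arguments IIdxInc {A}. Arguments IStop {A}. Arguments IOracle {A}.

(** A machine: number k of index registers and a program (labels 1..length). *)
Record machine (A : structure) : Type := {
  nidx : nat;
  prog : list (instr A)
}.

Definition zreg_ok (j : nat) : Prop := 1 <= j.
Definition ireg_ok {A : structure} (M : machine A) (j : nat) : Prop :=
  1 <= j <= nidx M.
Definition label_ok {A : structure} (M : machine A) (l : nat) : Prop :=
  1 <= l <= length (prog M).

Definition instr_ok {A : structure} (M : machine A) (ins : instr A) : Prop :=
  match ins with
  | IFun j i args => zreg_ok j /\ forall t, zreg_ok (args t)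
  | IConst j _ => zreg_ok j
  | ICopy j k => ireg_ok M j /\ ireg_ok M k
  | IRel i args l1 l2 => (forall t, zreg_ok (args t)) /\ label_ok M l1 /\ label_ok M l2
  | IIdxEq j k l1 l2 => ireg_ok M j /\ ireg_ok M k /\ label_ok M l1 /\ label_ok M l2
  | IIdxSet1 j => ireg_ok M j
  | IIdxInc j => ireg_ok M j
  | IStop => True
  | IOracle j => zreg_ok j
  end.

Definition is_stop {A : structure} (ins : instr A) : Prop :=
  match ins with IStop => True | _ => False end.

(** Well-formed machine: at least one index register (I_1 is used for input
    length), nonempty program whose last instruction is the only stop
    instruction, and all register / label references are in range. *)
Definition wf_machine {A : structure} (M : machine A) : Prop :=
  1 <= nidx M /\
  prog M <> [] /\
  (forall n ins, nth_error (prog M) n = Some ins ->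
     instr_ok M ins /\ (is_stop ins <-> n = length (prog M) - 1)).

Definition no_oracle {A : structure} (M : machine A) : Prop :=
  forall n j, nth_error (prog M) n <> Some (IOracle j).

Record config (A : structure) : Type := mkConfig {
  lab : nat;
  idx : nat -> nat;   (* I_j at position j *)
  reg : nat -> U A    (* Z_j at position j (position 0 unused) *)
}.

Arguments mkConfig {A}.

Definition fupd {T : Type} (f : nat -> T) (j : nat) (v : T) : nat -> T :=
  fun x => if Nat.eqb x j then v else f x.

Definition nu {A : structure} (Q : list (U A) -> Prop) (z : list (U A)) (y1 : U A) : Prop :=
  exists ys : list (U A), Q (z ++ y1 :: ys).

Definition query {A : structure} (c : config A) : list (U A) :=
  map (reg c) (seq 1 (idx c 1)).

(** One computation step of machine [M] with oracle [Q]
    (the oracle is irrelevant for machines without oracle instructions). *)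
Definition step {A : structure} (Q : list (U A) -> Prop) (M : machine A)
    (c c' : config A) : Prop :=
  match nth_error (prog M) (lab c - 1) with
  | Some (IFun j i args) =>
      c' = mkConfig (S (lab c)) (idx c) (fupd (reg c) j (fn A i (fun t => reg c (args t))))
  | Some (IConst j i) =>
      c' = mkConfig (S (lab c)) (idx c) (fupd (reg c) j (cst A i))
  | Some (ICopy j k) =>
      c' = mkConfig (S (lab c)) (idx c) (fupd (reg c) (idx c j) (reg c (idx c k)))
  | Some (IRel i args l1 l2) =>
      (rel A i (fun t => reg c (args t)) /\ c' = mkConfig l1 (idx c) (reg c)) \/
      (~ rel A i (fun t => reg c (args t)) /\ c' = mkConfig l2 (idx c) (reg c))
  | Some (IIdxEq j k l1 l2) =>
      (idx c j = idx c k /\ c' = mkConfig l1 (idx c) (reg c)) \/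
      (idx c j <> idx c k /\ c' = mkConfig l2 (idx c) (reg c))
  | Some (IIdxSet1 j) =>
      c' = mkConfig (S (lab c)) (fupd (idx c) j 1) (reg c)
  | Some (IIdxInc j) =>
      c' = mkConfig (S (lab c)) (fupd (idx c) j (S (idx c j))) (reg c)
  | Some (IOracle j) =>
      (* choose an arbitrary element of nu[Q](query); loop forever if empty *)
      (exists y, nu Q (query c) y /\ c' = mkConfig (S (lab c)) (idx c) (fupd (reg c) j y)) \/
      ((forall y, ~ nu Q (query c) y) /\ c' = c)
  | Some IStop => False
  | None => False
  end.

Inductive reach {A : structure} (Q : list (U A) -> Prop) (M : machine A)
  : config A -> config A -> Prop :=
| reach_refl : forall c, reach Q M c c
| reach_step : forall c c' c'', step Q M c c' -> reach Q M c' c'' -> reach Q M c c''.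

(** Initial configuration (1, (n,1,...,1), (w_1, ..., w_p, x_n, x_n, ...))
    where w = x ++ ys, n = length x, and [xn] is the last entry of x. *)
Definition init_config {A : structure} (x ys : list (U A)) (xn : U A) : config A :=
  mkConfig 1 (fun j => if Nat.eqb j 1 then length x else 1)
           (fun i => nth (pred i) (x ++ ys) xn).

Definition halted {A : structure} (M : machine A) (c : config A) : Prop :=
  lab c = length (prog M).

Definition halts_det {A : structure} (Q : list (U A) -> Prop) (M : machine A)
    (x : list (U A)) : Prop :=
  exists (a : U A) (r : list (U A)) (c' : config A),
    x = a :: r /\ reach Q M (init_config x [] (last x a)) c' /\ halted M c'.

(** Halting set of a non-deterministic machine: some guesses (y_1..y_m), m >= 1,
    give a halting computation from (1,(n,1,..,1),(x_1..x_n,y_1..y_m,x_n,x_n,..)). *)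
Definition halts_ND {A : structure} (M : machine A) (x : list (U A)) : Prop :=
  exists (a : U A) (r ys : list (U A)) (c' : config A),
    x = a :: r /\ ys <> [] /\
    reach (fun _ => False) M (init_config x ys (last x a)) c' /\ halted M c'.

Definition SDEC_ND (A : structure) (P : list (U A) -> Prop) : Prop :=
  exists M : machine A, wf_machine M /\ no_oracle M /\
    forall x, P x <-> halts_ND M x.

Definition SDEC_nu (A : structure) (Q : list (U A) -> Prop) (P : list (U A) -> Prop) : Prop :=
  exists M : machine A, wf_machine M /\
    forall x, P x <-> halts_det Q M x.

Definition Uinf (A : structure) : list (U A) -> Prop := fun l => l <> [].

(* Main.v *)
(** Both inclusions use the same simulation. The simulating machine keeps the
    registers of the simulated one in place, but only up to a frontier, and
    advances the frontier by one position before every simulated instruction.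
    Index registers grow by at most one per step, so the simulated machine never
    looks beyond the frontier, and its registers there may be treated as not yet
    specified: a guess is made, or the padding with the last input entry is
    extended, only when the frontier arrives.

    Since every element answers every query, answers and guesses play the same
    role: each simulated step consumes one arbitrary element. A guessing machine
    finds it among its own guesses just above the frontier, an oracle machine
    asks for it. Elements are consumed at this fixed rate because the structure
    may have no relation with which the control flow could depend on the number
    of guesses. *)

From Stdlib Require Import List Arith PeanoNat Lia Classical FunctionalExtensionality.
From Stdlib Require Fin.
Require Import Defs.
Import ListNotations.
Set Implicit Arguments.
Unset Strict Implicit.

Inductive nsteps {T : Type} (R : T -> T -> Prop) : nat -> T -> T -> Prop :=
| nsteps_0 : forall c, nsteps R 0 c c
| nsteps_S : forall n c c1 c2, R c c1 -> nsteps R n c1 c2 -> nsteps R (S n) c c2.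

Lemma nsteps_trans {T : Type} (R : T -> T -> Prop) n m a b c :
  nsteps R n a b -> nsteps R m b c -> nsteps R (n + m) a c.
Proof. induction 1; simpl; intros; eauto using nsteps_S. Qed.

Lemma nsteps_countdown {T : Type} (R : T -> T -> Prop) (P : nat -> T -> Prop) :
  (forall n c d, R c d -> (P n c <-> exists m, n = S m /\ P m d)) ->
  forall m n c d, nsteps R m c d -> (P n c <-> exists n', n = m + n' /\ P n' d).
Proof.
  intros HR m n c d Hr; revert n; induction Hr as [c|m c c1 d Hs _ IH]; intros n.
  - split; [now exists n|now intros (n' & -> & Hn)].
  - rewrite (HR n c c1 Hs); split.
    + intros (n1 & -> & Hn); apply IH in Hn as (n' & -> & Hn); now exists n'.
    + intros (n' & -> & Hn); exists (m + n'); split; trivial; apply IH; now exists n'.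
Qed.

Lemma fupd_eq {T : Type} (f : nat -> T) j v : fupd f j v j = v.
Proof. unfold fupd; now rewrite Nat.eqb_refl. Qed.

Lemma fupd_neq {T : Type} (f : nat -> T) j v i : i <> j -> fupd f j v i = f i.
Proof. unfold fupd; intros H; now rewrite (proj2 (Nat.eqb_neq _ _) H). Qed.

Lemma fupd_ext {T : Type} (f g : nat -> T) j v i :
  (i <> j -> f i = g i) -> fupd f j v i = fupd g j v i.
Proof. unfold fupd; destruct (Nat.eqb_spec i j); auto. Qed.

(** * Well-formed machines *)

Definition nonstop {A : structure} (ins : instr A) : Prop := ~ is_stop ins.

Lemma wf_machine_iff {A : structure} (M : machine A) :
  wf_machine M <->
  1 <= nidx M /\ Forall (instr_ok M) (prog M) /\
  exists front, prog M = front ++ [IStop] /\ Forall nonstop front.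
Proof.
  split.
  - intros (Hk & Hne & H); split; [exact Hk|].
    destruct (exists_last Hne) as (front & ins & Hp).
    split; [|exists front; split].
    + apply Forall_forall; intros i Hi; apply In_nth_error in Hi as [n Hn].
      apply (H n i Hn).
    + rewrite Hp; do 2 f_equal.
      destruct (H (length front) ins) as [_ Hs].
      { rewrite Hp, nth_error_app2, Nat.sub_diag; auto. }
      destruct ins; trivial; exfalso; apply Hs;
        rewrite Hp, length_app; simpl; lia.
    + apply Forall_forall; intros i Hi Hs; apply In_nth_error in Hi as [n Hn].
      assert (n < length front) by (apply nth_error_Some; congruence).
      destruct (H n i) as [_ Hst]; [rewrite Hp, nth_error_app1; auto|].
      apply Hst in Hs; rewrite Hp, length_app in Hs; simpl in Hs; lia.
  - intros (Hk & Hok & front & Hp & Hns); split; [exact Hk|split].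
    + rewrite Hp; destruct front; discriminate.
    + rewrite Forall_forall in Hok, Hns; intros n ins Hn; split.
      * eauto using nth_error_In.
      * rewrite Hp in *; rewrite length_app; simpl.
        rewrite nth_error_app in Hn; destruct (Nat.ltb_spec n (length front)).
        -- apply nth_error_In, Hns in Hn; unfold nonstop in Hn; split; [tauto|lia].
        -- destruct (n - length front) as [|[|]] eqn:Hd; try discriminate.
           injection Hn as <-; simpl; split; [lia|trivial].
Qed.

Lemma nth_error_stop {A : structure} (M : machine A) :
  wf_machine M -> nth_error (prog M) (length (prog M) - 1) = Some IStop.
Proof.
  intros H; apply wf_machine_iff in H as (_ & _ & front & -> & _).
  rewrite length_app, nth_error_app2; simpl; [|lia].
  now replace (_ - _) with 0 by lia.
Qed.

Lemma label_ok_nth_error {A : structure} (M : machine A) l :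
  label_ok M l -> exists ins, nth_error (prog M) (l - 1) = Some ins.
Proof.
  unfold label_ok; intros Hl; destruct (nth_error _ _) as [ins|] eqn:Hn; [now exists ins|].
  apply nth_error_None in Hn; lia.
Qed.

Lemma label_ok_S {A : structure} (M : machine A) l ins :
  wf_machine M -> label_ok M l -> nth_error (prog M) (l - 1) = Some ins -> ~ is_stop ins ->
  label_ok M (S l).
Proof.
  unfold label_ok; intros (_ & _ & H) Hl Hn Hs; apply H in Hn as [_ Hn].
  assert (l - 1 <> length (prog M) - 1) by tauto; lia.
Qed.

Definition zreg_le {A : structure} (B : nat) (ins : instr A) : Prop :=
  match ins with
  | IFun j i args => j <= B /\ forall t, args t <= B
  | IConst j _ => j <= B
  | IRel i args _ _ => forall t, args t <= B
  | IOracle j => j <= B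
  | _ => True
  end.

Lemma zreg_le_mono {A : structure} B B' (ins : instr A) :
  B <= B' -> zreg_le B ins -> zreg_le B' ins.
Proof.
  intros HB; destruct ins; simpl; try lia.
  - intros [H1 H2]; split; [lia|]; intros t; specialize (H2 t); lia.
  - intros H t; specialize (H t); lia.
Qed.

Lemma fin_fun_bounded m (f : Fin.t m -> nat) : exists B, forall t, f t <= B.
Proof.
  induction m as [|m IH].
  - exists 0; intros t; inversion t.
  - destruct (IH (fun t => f (Fin.FS t))) as [B HB].
    exists (max B (f Fin.F1)); intros t; apply (Fin.caseS' t); [lia|].
    intros t'; specialize (HB t'); simpl in HB; lia.
Qed.

Lemma zreg_bounded {A : structure} (p : list (instr A)) :
  exists B, 1 <= B /\ Forall (zreg_le B) p.
Proof.
  induction p as [|ins p [B [HB IH]]]; [exists 1; auto|].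
  assert (exists C, zreg_le C ins) as [C HC].
  { destruct ins; simpl; try (exists 0; exact I); try (exists j; lia).
    - destruct (fin_fun_bounded args) as [C HC]; exists (max C j); split; [lia|].
      intros t; specialize (HC t); lia.
    - apply fin_fun_bounded. }
  exists (max C B); split; [lia|].
  constructor; [eapply zreg_le_mono; [|exact HC]; lia|].
  eapply Forall_impl; [|exact IH]; intros a; apply zreg_le_mono; lia.
Qed.

Definition code_at {A : structure} (M : machine A) (l : nat) (code : list (instr A))
  : Prop :=
  exists p q, prog M = p ++ code ++ q /\ l = S (length p).

Lemma code_at_cons {A : structure} (M : machine A) l ins code :
  code_at M l (ins :: code) ->
  nth_error (prog M) (l - 1) = Some ins /\ code_at M (S l) code.
Proof.
  intros (p & q & Hp & ->); split.
  - rewrite Hp; simpl; rewrite Nat.sub_0_r, nth_error_app2, Nat.sub_diag; trivial.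
  - exists (p ++ [ins]), q; split; [now rewrite Hp, <- !app_assoc|].
    rewrite length_app; simpl; lia.
Qed.

Lemma code_at_app {A : structure} (M : machine A) l c1 c2 :
  code_at M l (c1 ++ c2) -> code_at M l c1 /\ code_at M (l + length c1) c2.
Proof.
  intros (p & q & Hp & ->); split.
  - exists p, (c2 ++ q); now rewrite Hp, <- !app_assoc.
  - exists (p ++ c1), q; rewrite length_app; split; [now rewrite Hp, <- !app_assoc|lia].
Qed.

(** * Computations with answered queries *)

Section Computations.
Variables (A : structure) (M : machine A).

Definition answered_step (y : U A) (c c' : config A) : Prop :=
  match nth_error (prog M) (lab c - 1) with
  | Some (IOracle j) => c' = mkConfig (S (lab c)) (idx c) (fupd (reg c) j y)
  | _ => step (Uinf A) M c c'
  end.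

Lemma nu_Uinf (z : list (U A)) y : nu (Uinf A) z y.
Proof. exists []; unfold Uinf; intros H; apply app_eq_nil in H as [_ H]; discriminate. Qed.

Lemma step_Uinf_iff c c' : step (Uinf A) M c c' <-> exists y, answered_step y c c'.
Proof.
  unfold answered_step, step; destruct (nth_error _ _) as [[]|];
    try (split; [exists (reg c 0)|intros [_ ?]]; assumption).
  split.
  - intros [(y & _ & ->)|[H _]]; [now exists y|].
    destruct (H (reg c 0)); apply nu_Uinf.
  - intros [y ->]; left; exists y; split; [apply nu_Uinf|reflexivity].
Qed.

Lemma answered_step_no_oracle Q y c c' :
  no_oracle M -> (answered_step y c c' <-> step Q M c c').
Proof.
  unfold no_oracle, answered_step, step; intros Ho.
  destruct (nth_error _ _) as [ins|] eqn:Hn; [|reflexivity].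
  destruct ins; try reflexivity; now apply Ho in Hn.
Qed.

Lemma answered_step_functional y c d d' :
  answered_step y c d -> answered_step y c d' -> d = d'.
Proof.
  unfold answered_step, step; intros H H'.
  destruct (nth_error _ _) as [[]|]; try congruence; try tauto;
    destruct H as [[? ->]|[? ->]], H' as [[? ->]|[? ->]]; tauto.
Qed.

Lemma answered_step_progress y c :
  wf_machine M -> label_ok M (lab c) -> ~ halted M c -> exists c', answered_step y c c'.
Proof.
  intros wfM Hl Hh; destruct (label_ok_nth_error Hl) as [ins Hn].
  unfold halted, label_ok, answered_step, step in *; rewrite Hn; destruct ins; eauto.
  - destruct (classic (rel A i (fun t => reg c (args t)))); eauto.
  - destruct (Nat.eq_dec (idx c j) (idx c k)); eauto.
  - exfalso; apply wfM in Hn as [_ Hn]; simpl in Hn; intuition lia.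
Qed.

Lemma answered_step_not_halted y c c' :
  wf_machine M -> answered_step y c c' -> ~ halted M c.
Proof.
  unfold halted, answered_step, step; intros wfM Hs Hl.
  now rewrite Hl, nth_error_stop in Hs.
Qed.

Lemma answered_step_label_ok y c c' :
  wf_machine M -> label_ok M (lab c) -> answered_step y c c' -> label_ok M (lab c').
Proof.
  unfold answered_step, step; intros wfM Hl Hs.
  destruct (nth_error _ _) as [ins|] eqn:Hn; [|contradiction].
  pose proof (label_ok_S wfM Hl Hn) as Hnext.
  destruct (proj2 (proj2 wfM) _ _ Hn) as [Hok _].
  destruct ins; simpl in *; try contradiction; try (subst c'; now apply Hnext);
    destruct Hs as [[_ ->]|[_ ->]]; simpl; tauto.
Qed.

Lemma answered_step_idx_le y c c' h :
  wf_machine M -> (forall r, 1 <= r <= nidx M -> idx c r <= h) -> answered_step y c c' ->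
  forall r, 1 <= r <= nidx M -> idx c' r <= S h.
Proof.
  unfold answered_step, step; intros wfM Hc Hs r Hr; pose proof (Hc r Hr) as Hcr.
  destruct (nth_error _ _) as [ins|] eqn:Hn; [|contradiction].
  destruct (proj2 (proj2 wfM) _ _ Hn) as [Hok _].
  destruct ins; simpl in *; try contradiction; try (subst c'; simpl; lia);
    try (destruct Hs as [[_ ->]|[_ ->]]; simpl; lia);
    subst c'; simpl; unfold fupd; destruct (r =? j); try lia.
  specialize (Hc j Hok); lia.
Qed.

Fixpoint halts_in (n : nat) (c : config A) : Prop :=
  match n with
  | 0 => halted M c
  | S n => exists y c', answered_step y c c' /\ halts_in n c'
  end.

Lemma halts_in_unfold n y c d :
  wf_machine M -> answered_step y c d ->
  (halts_in n c <-> exists m z c', n = S m /\ answered_step z c c' /\ halts_in m c').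
Proof.
  intros wfM Hd; split.
  - destruct n as [|n]; [intros H|intros (z & c' & Hc')].
    + destruct (answered_step_not_halted wfM Hd H).
    + now exists n, z, c'.
  - intros (m & z & c' & -> & Hc'); now exists z, c'.
Qed.

Lemma halts_in_reach Q c :
  (forall c c', step Q M c c' <-> exists y, answered_step y c c') ->
  (exists n, halts_in n c) <-> exists d, reach Q M c d /\ halted M d.
Proof.
  intros HQ; split.
  - intros [n Hn]; revert c Hn; induction n as [|n IH]; intros c.
    + exists c; split; [apply reach_refl|assumption].
    + intros (y & c' & Hs & Hn); destruct (IH c' Hn) as (d & Hr & Hd).
      exists d; split; [|exact Hd].
      apply reach_step with c'; [apply HQ; now exists y|exact Hr].
  - intros (d & Hr & Hd); induction Hr as [c|c c' d Hs _ IH].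
    + now exists 0.
    + destruct (IH Hd) as [n Hn]; apply HQ in Hs as [y Hy].
      now exists (S n), y, c'.
Qed.

(** * Locality *)

(* A query also reads [Z_1, ..., Z_{I_1}], but here its answers do not depend on them. *)
Definition touches_upto (h : nat) (c : config A) (ins : instr A) : Prop :=
  match ins with
  | ICopy j k => idx c j <= h /\ idx c k <= h
  | _ => zreg_le h ins
  end.

Definition local_at (h : nat) (c : config A) : Prop :=
  forall ins, nth_error (prog M) (lab c - 1) = Some ins -> touches_upto h c ins.

Lemma local_at_mono h h' c : h <= h' -> local_at h c -> local_at h' c.
Proof.
  intros Hh Hc ins Hn; specialize (Hc ins Hn).
  destruct ins; try exact (zreg_le_mono Hh Hc); simpl in *; lia.
Qed.

Lemma local_at_of_bounds B h c :
  wf_machine M -> Forall (zreg_le B) (prog M) -> B <= h ->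
  (forall r, 1 <= r <= nidx M -> idx c r <= h) -> local_at h c.
Proof.
  intros wfM HM HB Hc ins Hn; destruct (proj2 (proj2 wfM) _ _ Hn) as [Hok _].
  rewrite Forall_forall in HM; specialize (HM ins (nth_error_In _ _ Hn)).
  destruct ins; try exact (zreg_le_mono HB HM).
  split; apply Hc; apply Hok.
Qed.

Definition splice (h : nat) (f g : nat -> U A) (i : nat) : U A :=
  if i <=? h then f i else g i.

Lemma splice_le h f g i : i <= h -> splice h f g i = f i.
Proof. unfold splice; intros H; now rewrite (proj2 (Nat.leb_le _ _) H). Qed.

Lemma splice_gt h f g i : h < i -> splice h f g i = g i.
Proof. unfold splice; intros H; now rewrite (proj2 (Nat.leb_gt _ _) H). Qed.

Lemma splice_args h f g m (args : Fin.t m -> nat) :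
  (forall t, args t <= h) -> (fun t => splice h f g (args t)) = (fun t => f (args t)).
Proof. intros H; apply functional_extensionality; intros t; now apply splice_le. Qed.

Lemma splice_fupd h f g j v :
  j <= h -> splice h (fupd f j v) g = fupd (splice h f g) j v.
Proof.
  intros H; apply functional_extensionality; intros i; unfold splice, fupd.
  destruct (Nat.eqb_spec i j) as [->|]; trivial.
  now rewrite (proj2 (Nat.leb_le _ _) H).
Qed.

Definition overlay (h : nat) (g : nat -> U A) (c : config A) : config A :=
  mkConfig (lab c) (idx c) (splice h (reg c) g).

Lemma overlay_ext h h' g g' c c' :
  lab c = lab c' -> idx c = idx c' ->
  (forall i, splice h (reg c) g i = splice h' (reg c') g' i) ->
  overlay h g c = overlay h' g' c'.
Proof.
  unfold overlay; intros -> -> H; f_equal; now apply functional_extensionality.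
Qed.

Lemma overlay_overlay h f g c : overlay h f (overlay h g c) = overlay h f c.
Proof.
  apply overlay_ext; trivial; intros i; simpl; unfold splice; now destruct (i <=? h).
Qed.

Lemma overlay_reg h c : overlay h (reg c) c = c.
Proof.
  destruct c as [l i f]; unfold overlay; simpl; f_equal.
  apply functional_extensionality; intros r; unfold splice; now destruct (r <=? h).
Qed.

Lemma answered_step_overlay h g y c c' :
  local_at h c -> answered_step y c c' ->
  answered_step y (overlay h g c) (overlay h g c').
Proof.
  unfold local_at, answered_step, step; simpl lab.
  destruct (nth_error _ _) as [ins|]; [|trivial].
  intros Hl; specialize (Hl ins eq_refl); destruct ins; simpl in *; trivial.
  - intros ->; destruct Hl; unfold overlay; simpl.
    now rewrite splice_fupd, splice_args.
  - intros ->; unfold overlay; simpl; now rewrite splice_fupd.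
  - intros ->; destruct Hl; unfold overlay; simpl.
    now rewrite splice_fupd, splice_le.
  - rewrite splice_args by assumption.
    intros [[H ->]|[H ->]]; [left|right]; split; trivial.
  - intros [[H ->]|[H ->]]; [left|right]; split; trivial.
  - now intros ->.
  - now intros ->.
  - intros ->; unfold overlay; simpl; now rewrite splice_fupd.
Qed.

Lemma answered_step_overlay_inv h g y c d :
  local_at h c -> answered_step y (overlay h g c) d ->
  exists c', answered_step y c c' /\ d = overlay h g c'.
Proof.
  intros Hl Hd; pose proof (answered_step_overlay (c := overlay h g c) (reg c) Hl Hd) as Hc.
  rewrite overlay_overlay, overlay_reg in Hc.
  exists (overlay h (reg c) d); split; [exact Hc|].
  apply (answered_step_functional Hd), answered_step_overlay; assumption.
Qed.

Lemma answered_step_reg_gt h y c c' i :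
  local_at h c -> answered_step y c c' -> h < i -> reg c' i = reg c i.
Proof.
  intros Hl Hs Hi; pose proof (answered_step_overlay (reg c) Hl Hs) as Ho.
  rewrite overlay_reg in Ho; rewrite (answered_step_functional Hs Ho).
  now apply splice_gt.
Qed.

Definition det_step (c c' : config A) : Prop := forall y, answered_step y c c'.

Definition quiet_step (h : nat) (c c' : config A) : Prop := local_at h c /\ det_step c c'.

Lemma halts_in_quiet_step h n c d :
  wf_machine M -> quiet_step h c d ->
  (halts_in n c <-> exists m, n = S m /\ halts_in m d).
Proof.
  intros wfM [_ Hd]; rewrite (halts_in_unfold n wfM (Hd (reg c 0))); split.
  - intros (m & z & c' & -> & Hs & Hm); exists m; split; trivial.
    now rewrite (answered_step_functional (Hd z) Hs).
  - intros (m & -> & Hm); now exists m, (reg c 0), d.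
Qed.

Lemma halts_in_answer n c j :
  wf_machine M -> nth_error (prog M) (lab c - 1) = Some (IOracle j) ->
  (halts_in n c <->
   exists m y, n = S m /\ halts_in m (mkConfig (S (lab c)) (idx c) (fupd (reg c) j y))).
Proof.
  intros wfM H.
  assert (Hs : forall y c', answered_step y c c' <->
    c' = mkConfig (S (lab c)) (idx c) (fupd (reg c) j y)).
  { intros y c'; unfold answered_step; now rewrite H. }
  rewrite (halts_in_unfold n wfM (proj2 (Hs (reg c 0) _) eq_refl)); split.
  - intros (m & y & c' & -> & Hc' & Hm); apply Hs in Hc' as ->; now exists m, y.
  - intros (m & y & -> & Hm); eexists m, y, _; split; [reflexivity|split; [|exact Hm]].
    now apply Hs.
Qed.

Lemma quiet_inc h c j m :
  nth_error (prog M) (lab c - 1) = Some (IIdxInc j) -> idx c j = m ->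
  quiet_step h c (mkConfig (S (lab c)) (fupd (idx c) j (S m)) (reg c)).
Proof.
  intros H <-; split.
  - intros ins Hn; rewrite H in Hn; now injection Hn as <-.
  - intros y; unfold answered_step, step; now rewrite H.
Qed.

Lemma quiet_copy h c j k p q :
  nth_error (prog M) (lab c - 1) = Some (ICopy j k) ->
  idx c j = p -> idx c k = q -> p <= h -> q <= h ->
  quiet_step h c (mkConfig (S (lab c)) (idx c) (fupd (reg c) p (reg c q))).
Proof.
  intros H <- <- Hj Hk; split.
  - intros ins Hn; rewrite H in Hn; now injection Hn as <-.
  - intros y; unfold answered_step, step; now rewrite H.
Qed.

Lemma quiet_eq h c j k l1 l2 :
  nth_error (prog M) (lab c - 1) = Some (IIdxEq j k l1 l2) ->
  quiet_step h c (mkConfig (if idx c j =? idx c k then l1 else l2) (idx c) (reg c)).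
Proof.
  intros H; split.
  - intros ins Hn; rewrite H in Hn; now injection Hn as <-.
  - intros y; unfold answered_step, step; rewrite H.
    destruct (Nat.eqb_spec (idx c j) (idx c k)); [left|right]; auto.
Qed.

Lemma quiet_incs h rs :
  forall c, code_at M (lab c) (map IIdxInc rs) ->
  exists d, nsteps (quiet_step h) (length rs) c d /\ lab d = lab c + length rs /\
    reg d = reg c /\ forall r, idx d r = idx c r + count_occ Nat.eq_dec rs r.
Proof.
  induction rs as [|r rs IH]; simpl; intros c Hc.
  - exists c; repeat split; auto using nsteps_0; lia.
  - apply code_at_cons in Hc as [Hinc Hc].
    pose (c1 := mkConfig (S (lab c)) (fupd (idx c) r (S (idx c r))) (reg c)).
    assert (Hs : quiet_step h c c1) by now apply quiet_inc.
    destruct (IH c1 Hc) as (d & Hd & Hld & Hrd & Hid); simpl in *.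
    exists d; split; [eapply nsteps_S; eauto|split; [lia|split; [exact Hrd|]]].
    intros r'; rewrite Hid; unfold fupd.
    destruct (Nat.eq_dec r r') as [->|Hne].
    + rewrite Nat.eqb_refl; lia.
    + rewrite (proj2 (Nat.eqb_neq r' r)); auto.
Qed.

(** * Halting with unspecified registers *)

Definition set_reg (c : config A) (i : nat) (y : U A) : config A :=
  mkConfig (lab c) (idx c) (fupd (reg c) i y).

Lemma set_reg_same c i : set_reg c i (reg c i) = c.
Proof.
  destruct c as [l f g]; unfold set_reg; simpl; f_equal.
  apply functional_extensionality; intros j; unfold fupd.
  now destruct (Nat.eqb_spec j i) as [->|].
Qed.

Lemma splice_set_reg h c y g i :
  splice (S h) (reg (set_reg c (S h) y)) g i =
  splice h (reg c) (fun i => if i =? S h then y else g i) i.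
Proof.
  unfold splice, set_reg, fupd; simpl.
  destruct (Nat.leb_spec i h), (Nat.leb_spec i (S h)), (Nat.eqb_spec i (S h)); trivial; lia.
Qed.

Definition guess_tail (h : nat) (ys : list (U A)) (c : config A) : config A :=
  overlay h (fun i => nth (i - S h) ys (reg c i)) c.

Lemma guess_tail_nil h c : guess_tail h [] c = c.
Proof.
  rewrite <- (overlay_reg h c) at 2; apply overlay_ext; trivial; intros i; unfold splice.
  now destruct (i <=? h), (i - S h).
Qed.

Lemma guess_tail_cons h y ys c :
  guess_tail h (y :: ys) c = guess_tail (S h) ys (set_reg c (S h) y).
Proof.
  apply overlay_ext; trivial; intros i; rewrite splice_set_reg; unfold splice.
  destruct (Nat.leb_spec i h); trivial.
  destruct (Nat.eqb_spec i (S h)) as [->|Hi]; [now rewrite Nat.sub_diag|].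
  unfold set_reg; simpl reg; rewrite fupd_neq by exact Hi.
  now replace (i - S h) with (S (i - S (S h))) by lia.
Qed.

Definition halts_guessing (n h : nat) (c : config A) : Prop :=
  exists ys, halts_in n (guess_tail h ys c).

Lemma halts_guessing_guess n h c :
  halts_guessing n h c <-> exists y, halts_guessing n (S h) (set_reg c (S h) y).
Proof.
  split.
  - intros [[|y ys] H].
    + exists (reg c (S h)), []; rewrite guess_tail_nil in *.
      now rewrite set_reg_same.
    + exists y, ys; now rewrite <- guess_tail_cons.
  - intros (y & ys & H); exists (y :: ys); now rewrite guess_tail_cons.
Qed.

Lemma answered_step_guess_tail h ys y c c' :
  local_at h c -> answered_step y c c' ->
  overlay h (fun i => nth (i - S h) ys (reg c i)) c' = guess_tail h ys c'.
Proof.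
  intros Hl Hs; apply overlay_ext; trivial; intros i; unfold splice.
  destruct (Nat.leb_spec i h) as [_|Hi]; trivial.
  now rewrite (answered_step_reg_gt Hl Hs Hi).
Qed.

Lemma halts_guessing_step n h c :
  local_at h c ->
  (halts_guessing (S n) h c <-> exists y c', answered_step y c c' /\ halts_guessing n h c').
Proof.
  intros Hl; split.
  - intros (ys & y & d & Hs & Hd).
    destruct (answered_step_overlay_inv Hl Hs) as (c' & Hc' & ->).
    rewrite (answered_step_guess_tail ys Hl Hc') in Hd.
    exists y, c'; split; [|exists ys]; assumption.
  - intros (y & c' & Hs & ys & Hn); exists ys, y, (guess_tail h ys c'); split; trivial.
    rewrite <- (answered_step_guess_tail ys Hl Hs); now apply answered_step_overlay.
Qed.

Lemma halts_guessing_quiet_step h n c d :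
  wf_machine M -> quiet_step h c d ->
  (halts_guessing n h c <-> exists m, n = S m /\ halts_guessing m h d).
Proof.
  intros wfM [Hl Hd]; destruct n as [|n].
  - split; [intros [ys H]|now intros (m & ? & _)].
    destruct (answered_step_not_halted wfM (Hd (reg c 0)) H).
  - rewrite (halts_guessing_step n Hl); split.
    + intros (y & c' & Hs & Hn); rewrite (answered_step_functional Hs (Hd y)) in Hn; eauto.
    + intros (m & Hm & Hn); injection Hm as <-; exists (reg c 0), d; auto.
Qed.

Definition halts_padded (n h : nat) (c : config A) : Prop :=
  halts_in n (overlay h (fun _ => reg c h) c).

Lemma overlay_pad h c :
  overlay (S h) (fun _ => reg c h) (set_reg c (S h) (reg c h)) =
  overlay h (fun _ => reg c h) c.
Proof.
  apply overlay_ext; trivial; intros i; rewrite splice_set_reg; unfold splice.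
  now destruct (i <=? h), (i =? S h).
Qed.

Lemma halts_padded_pad n h c :
  halts_padded n h c <-> halts_padded n (S h) (set_reg c (S h) (reg c h)).
Proof.
  unfold halts_padded, set_reg at 1; simpl reg.
  now rewrite fupd_eq, overlay_pad.
Qed.

Lemma halts_padded_step n h c :
  local_at h c ->
  (halts_padded (S n) h c <-> exists y c',
     answered_step y (set_reg c (S h) (reg c h)) c' /\ halts_padded n (S h) c').
Proof.
  intros Hl; set (c0 := set_reg c (S h) (reg c h)).
  assert (Hl0 : local_at (S h) c0).
  { now apply (local_at_mono (c := c) (Nat.le_succ_diag_r h)). }
  assert (Hpad : forall y c', answered_step y c0 c' -> reg c' (S h) = reg c h).
  { intros y c' Hs; rewrite (answered_step_reg_gt (h := h) (c := c0) Hl Hs) by lia.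
    apply fupd_eq. }
  unfold halts_padded; rewrite <- overlay_pad; fold c0; split.
  - intros (y & d & Hs & Hd).
    destruct (answered_step_overlay_inv Hl0 Hs) as (c' & Hc' & ->).
    exists y, c'; rewrite (Hpad y c' Hc'); auto.
  - intros (y & c' & Hs & Hn); rewrite (Hpad y c' Hs) in Hn.
    exists y, (overlay (S h) (fun _ => reg c h) c'); split; trivial.
    now apply answered_step_overlay.
Qed.

End Computations.

(** * The simulating machine *)

Definition frontier (k : nat) : nat := S k.

Definition above (k : nat) : nat := S (S k).

(* [I_{pointer j}] holds [j], so that [ICopy] can access [Z_j]. *)
Definition pointer (k j : nat) : nat := above k + j.

(* A loop setting [I_frontier] to the input length [n] and [I_above] to [n + 1]. *)
Definition header {A : structure} (k : nat) : list (instr A) :=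
  [IIdxInc (above k); IIdxEq 1 (frontier k) 6 3; IIdxInc (frontier k);
   IIdxInc (above k); IIdxEq 1 1 2 2].

Definition pointer_incs (k B : nat) : list nat :=
  flat_map (fun j => repeat (pointer k j) (j - 1)) (seq 1 B).

(* The initial run of [advance] moves the frontier past every register that the
   simulated program addresses by its number. *)
Definition preamble {A : structure} (k B : nat) (advance : list (instr A))
  : list (instr A) :=
  header k ++ map IIdxInc (pointer_incs k B) ++ flat_map (fun _ => advance) (seq 0 B).

Definition warmup_label (k B E t : nat) : nat := 6 + length (pointer_incs k B) + E * t.

Definition new_label (k B E l : nat) : nat := warmup_label k B E B + S E * (l - 1).

Definition translate {A : structure} (k B E : nat) (ins : instr A) : instr A :=
  match ins with
  | IRel i args l1 l2 => IRel i args (new_label k B E l1) (new_label k B E l2)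
  | IIdxEq j j' l1 l2 => IIdxEq j j' (new_label k B E l1) (new_label k B E l2)
  | IOracle j => ICopy (pointer k j) (above k)
  | _ => ins
  end.

Definition block {A : structure} (k B : nat) (advance : list (instr A)) (ins : instr A)
  : list (instr A) :=
  advance ++ [translate k B (length advance) ins].

Definition compile {A : structure} (M : machine A) (B : nat) (advance : list (instr A))
  : machine A :=
  {| nidx := nidx M + 2 + B;
     prog := preamble (nidx M) B advance ++ flat_map (block (nidx M) B advance) (prog M) |}.

Lemma count_pointer_incs k B r :
  count_occ Nat.eq_dec (pointer_incs k B) r =
  if r <=? pointer k B then r - pointer k 1 else 0.
Proof.
  unfold pointer_incs, pointer; generalize (above k) as a; intros a; induction B as [|B IH].
  - simpl; destruct (Nat.leb_spec r (a + 0)); lia.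
  - rewrite seq_S, flat_map_app, count_occ_app, IH; simpl; rewrite app_nil_r.
    destruct (Nat.eq_dec r (a + S B)) as [->|Hne].
    + rewrite count_occ_repeat_eq by trivial.
      destruct (Nat.leb_spec (a + S B) (a + B)),
        (Nat.leb_spec (a + S B) (a + S B)); lia.
    + rewrite count_occ_repeat_neq by auto.
      destruct (Nat.leb_spec r (a + B)), (Nat.leb_spec r (a + S B)); lia.
Qed.

Record tracks {A : structure} (k B h : nat) (c c' : config A) : Prop := {
  tracks_frontier : idx c' (frontier k) = h;
  tracks_above : idx c' (above k) = S h;
  tracks_pointer : forall j, 1 <= j <= B -> idx c' (pointer k j) = j;
  tracks_idx : forall r, 1 <= r <= k -> idx c' r = idx c r;
  tracks_reg : forall i, i <= h -> reg c' i = reg c i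
}.

Section Compile.
Variables (A : structure) (M : machine A) (B : nat) (advance : list (instr A)).
Hypothesis wfM : wf_machine M.
Hypothesis zregM : Forall (zreg_le B) (prog M).

Let k := nidx M.
Let M' := compile M B advance.
Let E := length advance.

Lemma length_block (ins : instr A) : length (block k B advance ins) = S E.
Proof. unfold block; rewrite length_app; simpl; unfold E; lia. Qed.

Lemma length_blocks p : length (flat_map (block k B advance) p) = S E * length p.
Proof.
  rewrite (flat_map_constant_length (c := S E)); [lia|auto using length_block].
Qed.

Lemma length_advances s n : length (flat_map (fun _ : nat => advance) (seq s n)) = E * n.
Proof. rewrite (flat_map_constant_length (c := E)), length_seq; auto; lia. Qed.

Lemma length_preamble : S (length (preamble k B advance)) = new_label k B E 1.
Proof.
  unfold preamble; rewrite !length_app, length_map, length_advances; simpl.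
  unfold new_label, warmup_label; simpl; lia.
Qed.

Lemma header_at : code_at M' 1 (header k ++ map IIdxInc (pointer_incs k B)).
Proof.
  exists [],
    (flat_map (fun _ => advance) (seq 0 B) ++ flat_map (block k B advance) (prog M)).
  split; [|reflexivity].
  unfold M', compile, preamble; cbn [prog]; now rewrite <- !app_assoc.
Qed.

Lemma advance_at t : t < B -> code_at M' (warmup_label k B E t) advance.
Proof.
  intros Ht; exists (header k ++ map IIdxInc (pointer_incs k B) ++
    flat_map (fun _ => advance) (seq 0 t)),
    (flat_map (fun _ => advance) (seq (S t) (B - S t)) ++
     flat_map (block k B advance) (prog M)); split.
  - unfold M', compile, preamble; cbn [prog]; fold k.
    replace B with (t + S (B - S t)) at 2 by lia.
    rewrite seq_app, flat_map_app; simpl flat_map at 2; now rewrite <- !app_assoc.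
  - rewrite !length_app, length_map, length_advances; reflexivity.
Qed.

Lemma block_at l ins :
  1 <= l -> nth_error (prog M) (l - 1) = Some ins ->
  code_at M' (new_label k B E l) (block k B advance ins).
Proof.
  intros Hl Hn; apply nth_error_split in Hn as (p & q & Hp & Hlen).
  exists (preamble k B advance ++ flat_map (block k B advance) p),
    (flat_map (block k B advance) q); split.
  - unfold M', compile; cbn [prog]; fold k.
    rewrite Hp, flat_map_app; simpl; now rewrite <- !app_assoc.
  - rewrite length_app, length_blocks, Hlen, <- Nat.add_succ_l, length_preamble.
    unfold new_label; lia.
Qed.

Lemma new_label_S l : 1 <= l -> new_label k B E (S l) = S (new_label k B E l + E).
Proof.
  unfold new_label; intros Hl; destruct l as [|l]; [lia|].
  rewrite !Nat.sub_succ, !Nat.sub_0_r, Nat.mul_succ_r; lia.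
Qed.

Lemma length_compile : length (prog M') = new_label k B E (length (prog M)) + E.
Proof.
  apply Nat.succ_inj; rewrite <- new_label_S.
  - unfold M', compile; cbn [prog]; rewrite length_app, length_blocks, <- Nat.add_succ_l.
    fold k; rewrite length_preamble; unfold new_label; simpl; lia.
  - destruct wfM as (_ & Hne & _); destruct (prog M); [congruence|simpl; lia].
Qed.

Lemma new_label_ok l : label_ok M l -> label_ok M' (new_label k B E l).
Proof.
  unfold label_ok; rewrite length_compile; unfold new_label, warmup_label; nia.
Qed.

Lemma translate_instr_ok ins :
  instr_ok M ins -> zreg_le B ins -> instr_ok M' (translate k B E ins).
Proof.
  assert (Hreg : forall j, ireg_ok M j -> ireg_ok M' j) by (unfold ireg_ok; simpl; lia).
  pose proof new_label_ok.
  clear zregM; destruct ins; simpl; intros Hok HB; intuition auto.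
  all: unfold zreg_ok, ireg_ok, pointer, above in *; simpl; fold k; lia.
Qed.

Lemma header_instr_ok : Forall (instr_ok M') (header k ++ map IIdxInc (pointer_incs k B)).
Proof.
  assert (Hlen : 6 <= length (prog M')).
  { rewrite length_compile; unfold new_label, warmup_label; lia. }
  destruct wfM as (Hk & _); fold k in Hk.
  apply Forall_app; split.
  - unfold header; rewrite !Forall_cons_iff; simpl.
    unfold ireg_ok, label_ok, above, frontier; simpl nidx; fold k; intuition (auto; lia).
  - apply Forall_map, Forall_forall; intros r Hr.
    apply in_flat_map in Hr as (j & Hj & Hr); apply in_seq in Hj.
    apply repeat_spec in Hr; subst r.
    simpl; unfold ireg_ok, pointer, above; simpl; fold k; lia.
Qed.

Lemma compile_instr_ok : Forall (instr_ok M') advance -> Forall (instr_ok M') (prog M').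
Proof.
  intros Hadv; pose proof header_instr_ok as Hh; apply Forall_app in Hh as [Hh Hi].
  apply Forall_app; split.
  - unfold preamble; rewrite !Forall_app; repeat split; trivial.
    apply Forall_flat_map, Forall_forall; trivial.
  - apply Forall_flat_map, Forall_forall; intros ins Hins.
    apply Forall_app; split; [exact Hadv|].
    pose proof (proj1 (wf_machine_iff M) wfM) as (_ & HokM & _).
    constructor; [|constructor].
    apply translate_instr_ok; eapply Forall_forall; eassumption.
Qed.

Lemma compile_wf :
  Forall (instr_ok M') advance -> Forall nonstop advance -> wf_machine M'.
Proof.
  intros Hok Hns; apply wf_machine_iff.
  pose proof (proj1 (wf_machine_iff M) wfM) as (_ & _ & front & Hp & Hfr).
  split; [simpl; destruct wfM; lia|split; [now apply compile_instr_ok|]].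
  exists (preamble k B advance ++ flat_map (block k B advance) front ++ advance); split.
  - unfold M', compile, block; cbn [prog]; fold k.
    rewrite Hp, flat_map_app; simpl; now rewrite <- !app_assoc.
  - unfold preamble; rewrite !Forall_app; repeat split; trivial.
    + unfold header, nonstop; repeat constructor; simpl; tauto.
    + apply Forall_map, Forall_forall; intros r _; unfold nonstop; simpl; tauto.
    + apply Forall_flat_map, Forall_forall; auto.
    + apply Forall_flat_map; eapply Forall_impl; [|exact Hfr].
      intros ins Hins; apply Forall_app; split; [assumption|].
      repeat constructor; unfold nonstop in *; destruct ins; simpl in *; tauto.
Qed.

Lemma compile_no_oracle : (forall j, ~ In (IOracle j) advance) -> no_oracle M'.
Proof.
  intros Hadv n j Hn; apply nth_error_In in Hn.
  unfold M', compile, preamble in Hn; simpl in Hn.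
  rewrite !in_app_iff, !in_flat_map, in_map_iff in Hn.
  destruct Hn as [H|[H|[H|[H|[H|[[H|H]|H]]]]]]; try discriminate.
  - now destruct H as (r & H & _).
  - destruct H as (_ & _ & H); now apply Hadv in H.
  - destruct H as (ins & _ & H); apply in_app_iff in H as [H|[H|[]]].
    + now apply Hadv in H.
    + destruct ins; discriminate.
Qed.

Lemma header_iteration h i f :
  i 1 <> i (frontier k) ->
  exists i', nsteps (quiet_step M' h) 4 (mkConfig 2 i f) (mkConfig 2 i' f) /\
    i' (frontier k) = S (i (frontier k)) /\ i' (above k) = S (i (above k)) /\
    forall r, r <> frontier k -> r <> above k -> i' r = i r.
Proof.
  intros Hne.
  destruct (code_at_cons header_at) as [_ Hh1]; destruct (code_at_cons Hh1) as [Htest Hh2].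
  destruct (code_at_cons Hh2) as [Hincf Hh3]; destruct (code_at_cons Hh3) as [Hinca Hh4].
  destruct (code_at_cons Hh4) as [Hback _].
  pose (i2 := fupd i (frontier k) (S (i (frontier k)))).
  pose (i3 := fupd i2 (above k) (S (i2 (above k)))).
  exists i3; split.
  - pose proof (quiet_eq (c := mkConfig 2 i f) h Htest) as Hs; simpl in Hs.
    rewrite (proj2 (Nat.eqb_neq _ _) Hne) in Hs.
    eapply nsteps_S; [exact Hs|].
    eapply nsteps_S; [apply (quiet_inc (c := mkConfig 3 i f) h Hincf eq_refl)|].
    eapply nsteps_S; [apply (quiet_inc (c := mkConfig 4 i2 f) h Hinca eq_refl)|].
    eapply nsteps_S; [|apply nsteps_0].
    pose proof (quiet_eq (c := mkConfig 5 i3 f) h Hback) as Hs'.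
    now rewrite Nat.eqb_refl in Hs'.
  - assert (frontier k <> above k) by (unfold frontier, above; lia).
    unfold i3, i2; split; [now rewrite fupd_neq, fupd_eq|split].
    + now rewrite fupd_eq, fupd_neq by auto.
    + intros r Hrf Hra; now rewrite !fupd_neq.
Qed.

Lemma header_loop h f g : forall i,
  i 1 = i (frontier k) + g -> i (above k) = S (i (frontier k)) ->
  exists m i', nsteps (quiet_step M' h) m (mkConfig 2 i f) (mkConfig 6 i' f) /\
    i' (frontier k) = i 1 /\ i' (above k) = S (i 1) /\
    forall r, r <> frontier k -> r <> above k -> i' r = i r.
Proof.
  pose proof (proj1 wfM) as Hk; fold k in Hk.
  induction g as [|g IH]; intros i Hg Ha.
  - destruct (code_at_cons header_at) as [_ Hh]; destruct (code_at_cons Hh) as [Htest _].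
    pose proof (quiet_eq (c := mkConfig 2 i f) h Htest) as Hs; simpl in Hs.
    rewrite (proj2 (Nat.eqb_eq _ _)) in Hs by lia.
    exists 1, i; split; [eapply nsteps_S; [exact Hs|apply nsteps_0]|].
    repeat split; intros; lia.
  - destruct (@header_iteration h i f) as (i1 & Hs & Hf1 & Ha1 & Hi1); [lia|].
    assert (H1 : i1 1 = i 1) by (apply Hi1; unfold frontier, above; lia).
    destruct (IH i1) as (m & i' & Hm & Hf' & Ha' & Hi'); [lia|lia|].
    exists (4 + m), i'; split; [eapply nsteps_trans; eauto|].
    rewrite Hf', Ha', H1; repeat split; intros r Hrf Hra; rewrite Hi', Hi1; auto.
Qed.

Lemma header_run h n c :
  1 <= n -> lab c = 1 -> (forall r, idx c r = if r =? 1 then n else 1) ->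
  exists m d, nsteps (quiet_step M' h) m c d /\
    lab d = warmup_label k B E 0 /\ tracks k B n c d.
Proof.
  destruct c as [l i f]; simpl; intros Hn -> Hi; pose proof (proj1 wfM) as Hk; fold k in Hk.
  assert (Hi1 : i 1 = n) by apply Hi.
  assert (Hi' : forall r, k < r -> i r = 1).
  { intros r Hr; rewrite Hi; now rewrite (proj2 (Nat.eqb_neq r 1)) by lia. }
  pose (i1 := fupd i (above k) (S (i (above k)))).
  destruct (code_at_cons header_at) as [Hinc _].
  destruct (code_at_app header_at) as [_ Hincs].
  assert (Ha1 : i1 (above k) = 2).
  { unfold i1; now rewrite fupd_eq, Hi' by (unfold above; lia). }
  assert (Hi1' : forall r, r <> above k -> i1 r = i r) by (intros; now apply fupd_neq).
  assert (Hf1 : i1 (frontier k) = 1) by (rewrite Hi1', Hi'; unfold above, frontier; lia).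
  assert (Hn1 : i1 1 = n) by (rewrite Hi1', Hi1; unfold above; lia).
  destruct (@header_loop h f (n - 1) i1) as (m & i2 & Hm & Hf2 & Ha2 & Hi2); [lia|lia|].
  assert (Hi2' : forall r, r <> frontier k -> r <> above k -> i2 r = i r).
  { intros r Hrf Hra; rewrite Hi2, Hi1'; trivial. }
  destruct (quiet_incs (c := mkConfig 6 i2 f) h Hincs) as (d & Hd & Hld & Hrd & Hid).
  exists (S m + length (pointer_incs k B)), d; split; [|split].
  - eapply nsteps_trans; [eapply nsteps_S|exact Hd]; [|exact Hm].
    apply (quiet_inc (c := mkConfig 1 i f) h Hinc eq_refl).
  - rewrite Hld; unfold warmup_label; simpl; lia.
  - assert (Hlow : forall r, r <= above k -> idx d r = i2 r).
    { intros r Hr; rewrite Hid, count_pointer_incs; unfold pointer.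
      simpl idx; destruct (Nat.leb_spec r (above k + B)); lia. }
    constructor; intros.
    + rewrite Hlow by (unfold frontier, above; lia); lia.
    + rewrite Hlow; lia.
    + rewrite Hid, count_pointer_incs; unfold pointer; simpl idx.
      rewrite Hi2', Hi' by (unfold frontier, above; lia).
      rewrite (proj2 (Nat.leb_le _ _)); lia.
    + rewrite Hlow, Hi2' by (unfold frontier, above; lia); reflexivity.
    + now rewrite Hrd.
Qed.

Lemma translate_at l ins :
  label_ok M l -> nth_error (prog M) (l - 1) = Some ins ->
  nth_error (prog M') (new_label k B E l + E - 1) = Some (translate k B E ins).
Proof.
  intros Hl Hn; apply code_at_cons with (code := []).
  exact (proj2 (code_at_app (block_at (proj1 Hl) Hn))).
Qed.

Lemma translate_step y b b' d :
  label_ok M (lab b) -> answered_step M y b b' ->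
  lab d = new_label k B E (lab b) + E -> reg d = reg b ->
  (forall r, 1 <= r <= k -> idx d r = idx b r) ->
  (forall j, 1 <= j <= B -> idx d (pointer k j) = j) -> reg d (idx d (above k)) = y ->
  exists d', det_step M' d d' /\ lab d' = new_label k B E (lab b') /\ reg d' = reg b' /\
    (forall r, 1 <= r <= k -> idx d' r = idx b' r) /\
    (forall r, k < r -> idx d' r = idx d r).
Proof.
  unfold answered_step, step; intros Hl Hs Hld Hrd Hid Hp Hy.
  destruct (nth_error (prog M) (lab b - 1)) as [ins|] eqn:Hn; [|contradiction].
  destruct (proj2 (proj2 wfM) _ _ Hn) as [Hok _].
  assert (Hz : zreg_le B ins) by (eapply Forall_forall; eauto using nth_error_In).
  assert (HS : S (lab d) = new_label k B E (S (lab b))).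
  { rewrite Hld, new_label_S; [reflexivity|apply Hl]. }
  pose proof (translate_at Hl Hn) as Hn'; rewrite <- Hld in Hn'.
  unfold det_step, answered_step, step; rewrite Hn'.
  destruct ins; simpl in *; try contradiction.
  - subst b'; eexists; split; [reflexivity|]; rewrite Hrd; auto.
  - subst b'; eexists; split; [reflexivity|]; rewrite Hrd; auto.
  - destruct Hok as [Hj Hk]; subst b'; eexists; split; [reflexivity|]; simpl.
    rewrite (Hid _ Hj), (Hid _ Hk), Hrd; auto.
  - rewrite Hrd; destruct Hs as [[H ->]|[H ->]].
    + eexists; split; [left; split; [exact H|reflexivity]|]; auto.
    + eexists; split; [right; split; [exact H|reflexivity]|]; auto.
  - destruct Hok as (Hj & Hk & _); rewrite (Hid _ Hj), (Hid _ Hk).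
    destruct Hs as [[H ->]|[H ->]].
    + eexists; split; [left; split; [exact H|reflexivity]|]; auto.
    + eexists; split; [right; split; [exact H|reflexivity]|]; auto.
  - subst b'; eexists; split; [reflexivity|]; simpl; repeat split; trivial; intros r Hr.
    + apply fupd_ext; auto.
    + apply fupd_neq; destruct Hok; unfold k in *; lia.
  - subst b'; eexists; split; [reflexivity|]; simpl; repeat split; trivial; intros r Hr.
    + rewrite (Hid _ Hok); apply fupd_ext; auto.
    + apply fupd_neq; destruct Hok; unfold k in *; lia.
  - subst b'; eexists; split; [reflexivity|]; simpl; rewrite Hp, Hy, Hrd by auto; auto.
Qed.

Lemma local_at_translate h c d :
  label_ok M (lab c) -> B <= h -> (forall r, 1 <= r <= k -> idx c r <= h) ->
  tracks k B (S h) c d -> lab d = new_label k B E (lab c) + E -> local_at M' (S (S h)) d.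
Proof.
  intros Hl HB Hc Ht Hld ins' Hn'; rewrite Hld in Hn'.
  destruct (label_ok_nth_error Hl) as [ins Hn].
  destruct (proj2 (proj2 wfM) _ _ Hn) as [Hok _].
  assert (Hz : zreg_le B ins) by (eapply Forall_forall; eauto using nth_error_In).
  rewrite (translate_at Hl Hn) in Hn'; injection Hn' as <-.
  destruct ins; try (apply (zreg_le_mono (B := B)); [lia|exact Hz]).
  - destruct Hok as [Hj Hk]; simpl; rewrite !(tracks_idx Ht) by assumption.
    pose proof (Hc _ Hj); pose proof (Hc _ Hk); lia.
  - simpl in *; unfold zreg_ok in Hok.
    rewrite (tracks_pointer Ht), (tracks_above Ht) by lia; lia.
Qed.

Lemma tracks_step y h c c' d :
  label_ok M (lab c) -> B <= h -> (forall r, 1 <= r <= k -> idx c r <= h) ->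
  tracks k B (S h) c d -> reg d (S (S h)) = y -> lab d = new_label k B E (lab c) + E ->
  answered_step M y c c' ->
  exists d', quiet_step M' (S (S h)) d d' /\ tracks k B (S h) c' d' /\
    lab d' = new_label k B E (lab c').
Proof.
  intros Hl HB Hc Ht Hy Hld Hs.
  (* [c] and [d] differ beyond the frontier; by locality, the step of [c] may be
     taken with the registers of [d] there. *)
  assert (Hloc : local_at M (S h) c).
  { apply (local_at_mono (Nat.le_succ_diag_r h)), (local_at_of_bounds wfM zregM HB Hc). }
  pose proof (answered_step_overlay (reg d) Hloc Hs) as Ho.
  destruct (translate_step (b := overlay (S h) (reg d) c) (d := d) Hl Ho)
    as (d' & Hd & Hld' & Hrd & Hid & Hid'); trivial.
  - apply functional_extensionality; intros i; simpl; unfold splice.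
    destruct (Nat.leb_spec i (S h)); trivial; now apply (tracks_reg Ht).
  - apply Ht.
  - apply Ht.
  - now rewrite (tracks_above Ht).
  - exists d'; split; [|split; [|exact Hld']].
    { split; [eapply local_at_translate; eassumption|exact Hd]. }
    constructor.
    + rewrite Hid' by (unfold frontier; lia); apply Ht.
    + rewrite Hid' by (unfold above; lia); apply Ht.
    + intros j Hj; rewrite Hid' by (unfold pointer, above; lia).
      now apply (tracks_pointer Ht).
    + exact Hid.
    + intros i Hi; rewrite Hrd; simpl; now apply splice_le.
Qed.

Section Simulation.

(* The numbers are the length of the computation and the frontier [h]; both
   predicates leave the simulated registers beyond [h] unspecified. [fill h y]
   gives the content of the next one if the current step consumes [y]. *)
Variable source_halts target_halts : nat -> nat -> config A -> Prop.
Variable fill : nat -> U A -> config A -> U A.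

Let extend (h : nat) (y : U A) (c : config A) : config A := set_reg c (S h) (fill h y c).

Hypothesis source_halts_0 : forall h c, source_halts 0 h c <-> halted M c.
Hypothesis source_halts_extend : forall n h c,
  source_halts n h c <-> exists y, source_halts n (S h) (extend h y c).
Hypothesis source_halts_step : forall n h c, local_at M h c ->
  (source_halts (S n) h c <->
   exists y c', answered_step M y (extend h y c) c' /\ source_halts n (S h) c').

Hypothesis target_halts_0 : forall h c, halted M' c -> target_halts 0 h c.
Hypothesis target_halts_step : forall n h c d, quiet_step M' (S h) c d ->
  (target_halts n h c <-> exists m, n = S m /\ target_halts m h d).
Hypothesis target_halts_advance : forall h c c',
  1 <= h -> tracks k B h c c' -> code_at M' (lab c') advance ->
  exists d : U A -> config A,
    (forall y, tracks k B (S h) (extend h y c) (d y) /\ reg (d y) (S (S h)) = y /\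
       lab (d y) = lab c' + E) /\
    forall n, target_halts n h c' <-> exists m y, n = E + m /\ target_halts m (S h) (d y).

Record simulates (h : nat) (c c' : config A) : Prop := {
  simulates_tracks : tracks k B h c c';
  simulates_idx_le : forall r, 1 <= r <= k -> idx c r <= h;
  simulates_pos : 1 <= h;
  simulates_zreg : B <= h;
  simulates_label : label_ok M (lab c);
  simulates_new_label : lab c' = new_label k B E (lab c)
}.

Lemma simulates_local h c c' : simulates h c c' -> local_at M h c.
Proof.
  intros Hs; apply (local_at_of_bounds wfM zregM (simulates_zreg Hs) (simulates_idx_le Hs)).
Qed.

Lemma simulates_advance_at h c c' : simulates h c c' -> code_at M' (lab c') advance.
Proof.
  intros Hs; pose proof (simulates_label Hs) as Hl.
  destruct (label_ok_nth_error Hl) as [ins Hn]; rewrite (simulates_new_label Hs).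
  exact (proj1 (code_at_app (block_at (proj1 Hl) Hn))).
Qed.

Lemma simulates_advance h c c' :
  simulates h c c' ->
  exists d : U A -> config A,
    (forall y, lab (d y) = new_label k B E (lab c) + E) /\
    (forall y c1, answered_step M y (extend h y c) c1 ->
       exists d1, quiet_step M' (S (S h)) (d y) d1 /\ simulates (S h) c1 d1) /\
    forall n, target_halts n h c' <-> exists m y, n = E + m /\ target_halts m (S h) (d y).
Proof.
  intros Hs; pose proof (simulates_advance_at Hs) as Hcode.
  destruct Hs as [Ht Hi Hh HB Hl Hl'].
  destruct (target_halts_advance Hh Ht Hcode) as (d & Hd & Hn).
  exists d; split; [|split; [|exact Hn]].
  - intros y; destruct (Hd y) as (_ & _ & ->); now rewrite Hl'.
  - intros y c1 Hc1; destruct (Hd y) as (Hty & Hy & Hly); rewrite Hl' in Hly.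
    destruct (tracks_step (c := extend h y c) Hl HB Hi Hty Hy Hly Hc1)
      as (d1 & Hq & Ht1 & Hl1).
    exists d1; split; [exact Hq|]; constructor; trivial; try lia.
    + exact (answered_step_idx_le (c := extend h y c) wfM Hi Hc1).
    + exact (answered_step_label_ok (c := extend h y c) wfM Hl Hc1).
Qed.

Lemma source_halts_target n : forall h c c',
  simulates h c c' -> source_halts n h c -> exists m, target_halts m h c'.
Proof.
  induction n as [|n IH]; intros h c c' Hs Hn;
    destruct (simulates_advance Hs) as (d & Hl & Hstep & Hadv).
  - apply source_halts_0 in Hn; exists (E + 0); apply Hadv; exists 0, (reg c 0).
    split; trivial; apply target_halts_0; unfold halted in *.
    now rewrite Hl, Hn, length_compile.
  - apply source_halts_step in Hn as (y & c1 & Hc1 & Hn); [|apply (simulates_local Hs)].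
    destruct (Hstep y c1 Hc1) as (d1 & Hd1 & Hs1).
    destruct (IH _ _ _ Hs1 Hn) as [m Hm].
    exists (E + S m); apply Hadv; exists (S m), y; split; trivial.
    apply (target_halts_step _ Hd1); now exists m.
Qed.

Lemma target_halts_source n : forall h c c',
  simulates h c c' -> target_halts n h c' -> exists m, source_halts m h c.
Proof.
  induction n as [n IH] using lt_wf_ind; intros h c c' Hs Hn.
  destruct (classic (halted M c)) as [Hc|Hc]; [exists 0; now apply source_halts_0|].
  destruct (simulates_advance Hs) as (d & _ & Hstep & Hadv).
  apply Hadv in Hn as (m & y & -> & Hm).
  destruct (answered_step_progress (c := extend h y c) y wfM (simulates_label Hs) Hc)
    as [c1 Hc1].
  destruct (Hstep y c1 Hc1) as (d1 & Hd1 & Hs1).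
  apply (target_halts_step _ Hd1) in Hm as (m' & -> & Hm).
  destruct (IH m' ltac:(lia) _ _ _ Hs1 Hm) as [p Hp].
  exists (S p); apply source_halts_step; [apply (simulates_local Hs)|now exists y, c1].
Qed.

Lemma warmup_halts n s : forall t c c',
  t + s = B -> 1 <= n -> lab c = 1 -> (forall r, 1 <= r <= k -> idx c r <= n) ->
  tracks k B (n + t) c c' -> lab c' = warmup_label k B E t ->
  ((exists m, source_halts m (n + t) c) <-> exists m, target_halts m (n + t) c').
Proof.
  induction s as [|s IH]; intros t c c' HtB Hn Hl Hi Ht Hl'.
  - assert (Hs : simulates (n + t) c c').
    { constructor; trivial; try lia.
      - intros r Hr; specialize (Hi r Hr); lia.
      - rewrite Hl; destruct wfM as (_ & Hne & _); unfold label_ok.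
        destruct (prog M); [congruence|simpl; lia].
      - rewrite Hl, Hl'; unfold new_label; rewrite Nat.sub_diag, Nat.mul_0_r.
        replace t with B; lia. }
    split; intros [m Hm]; eauto using source_halts_target, target_halts_source.
  - destruct (target_halts_advance (c' := c') (h := n + t) ltac:(lia) Ht)
      as (d & Hd & Hadv).
    { rewrite Hl'; apply advance_at; lia. }
    assert (Hnext : forall y,
      (exists m, source_halts m (S (n + t)) (extend (n + t) y c)) <->
      exists m, target_halts m (S (n + t)) (d y)).
    { intros y; destruct (Hd y) as (Hty & _ & Hly); rewrite <- Nat.add_succ_r in *.
      apply IH; trivial; [lia|]; rewrite Hly, Hl'; unfold warmup_label.
      rewrite Nat.mul_succ_r; lia. }
    split.
    + intros [m Hm]; apply source_halts_extend in Hm as [y Hm].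
      destruct (proj1 (Hnext y)) as [m' Hm']; [now exists m|].
      exists (E + m'); apply Hadv; now exists m', y.
    + intros [m Hm]; apply Hadv in Hm as (m' & y & -> & Hm).
      destruct (proj2 (Hnext y)) as [p Hp]; [now exists m'|].
      exists p; apply source_halts_extend; now exists y.
Qed.

Lemma compile_halts n c c' :
  1 <= n -> lab c = 1 -> (forall r, idx c r = if r =? 1 then n else 1) ->
  lab c' = 1 -> idx c' = idx c -> (forall i, i <= n -> reg c' i = reg c i) ->
  ((exists m, source_halts m n c) <-> exists m, target_halts m n c').
Proof.
  intros Hn Hl Hi Hl' Hi' Hr.
  destruct (@header_run (S n) n c') as (p & d & Hp & Hld & Ht); trivial.
  { intros r; rewrite Hi'; apply Hi. }
  assert (Htc : tracks k B n c d).
  { destruct Ht as [Tf Ta Tp Ti Tr]; constructor; trivial.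
    - intros r Hrk; now rewrite Ti, Hi'.
    - intros i Hin; now rewrite Tr, Hr. }
  rewrite <- (Nat.add_0_r n) in Htc.
  pose proof (@warmup_halts n B 0 c d) as Hw; rewrite Nat.add_0_r in *.
  assert (Hrun : forall m,
    target_halts m n c' <-> exists m', m = p + m' /\ target_halts m' n d).
  { intros m; apply (nsteps_countdown (R := quiet_step M' (S n))
      (P := fun m => target_halts m n)); auto. }
  rewrite Hw; trivial.
  - split; intros [m Hm].
    + exists (p + m); apply Hrun; now exists m.
    + apply Hrun in Hm as (m' & _ & Hm); now exists m'.
  - intros r _; rewrite Hi; destruct (r =? 1); lia.
Qed.

End Simulation.
End Compile.

Definition advance_idx (k h : nat) (i : nat -> nat) : nat -> nat :=
  fupd (fupd i (frontier k) (S h)) (above k) (S (S h)).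

Lemma advance_idx_frontier k h i : advance_idx k h i (frontier k) = S h.
Proof.
  unfold advance_idx; rewrite fupd_neq; [apply fupd_eq|unfold frontier, above; lia].
Qed.

Lemma advance_idx_above k h i : advance_idx k h i (above k) = S (S h).
Proof. apply fupd_eq. Qed.

Lemma advance_idx_pointer k h i j :
  1 <= j -> advance_idx k h i (pointer k j) = i (pointer k j).
Proof.
  intros Hj; unfold advance_idx; rewrite !fupd_neq;
    unfold pointer, frontier, above; trivial; lia.
Qed.

Lemma advance_idx_le k h i r : r <= k -> advance_idx k h i r = i r.
Proof.
  intros Hr; unfold advance_idx; rewrite !fupd_neq; unfold frontier, above; trivial; lia.
Qed.

Lemma tracks_advance {A : structure} k B h (c c' : config A) l f v :
  tracks k B h c c' -> (forall i, i <= h -> f i = reg c' i) -> f (S h) = v ->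
  tracks k B (S h) (set_reg c (S h) v) (mkConfig l (advance_idx k h (idx c')) f).
Proof.
  intros [_ _ Tp Ti Tr] Hf HS; constructor; simpl.
  - apply advance_idx_frontier.
  - apply advance_idx_above.
  - intros j Hj; rewrite advance_idx_pointer by lia; auto.
  - intros r Hr; rewrite advance_idx_le by lia; auto.
  - intros i Hi; destruct (Nat.eq_dec i (S h)) as [->|Hne].
    + now rewrite fupd_eq.
    + rewrite fupd_neq, Hf by lia; apply Tr; lia.
Qed.

Lemma quiet_advance_idx {A : structure} (M : machine A) k h h' c code :
  idx c (frontier k) = h -> idx c (above k) = S h ->
  code_at M (lab c) (IIdxInc (frontier k) :: IIdxInc (above k) :: code) ->
  nsteps (quiet_step M h') 2 c (mkConfig (2 + lab c) (advance_idx k h (idx c)) (reg c)).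
Proof.
  intros Hf Ha Hcode; destruct (code_at_cons Hcode) as [Hincf Hcode'].
  destruct (code_at_cons Hcode') as [Hinca _].
  eapply nsteps_S; [apply quiet_inc; [exact Hincf|exact Hf]|].
  eapply nsteps_S; [apply quiet_inc; [exact Hinca|]|apply nsteps_0].
  simpl; rewrite fupd_neq; [exact Ha|unfold frontier, above; lia].
Qed.

(** * Halting sets *)

Definition input_config {A : structure} (x : list (U A)) (a : U A) : config A :=
  init_config x [] (last x a).

Lemma reg_input_config {A : structure} (x : list (U A)) a i :
  x <> [] -> length x <= i -> reg (input_config x a) i = last x a.
Proof.
  intros Hx Hi; simpl; rewrite app_nil_r.
  destruct (exists_last Hx) as (z & b & ->).
  rewrite length_app in Hi; simpl in Hi; rewrite last_last.
  rewrite app_nth2 by lia; now destruct (pred i - length z) as [|[|]].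
Qed.

Lemma overlay_input_config {A : structure} (x : list (U A)) a :
  x <> [] ->
  overlay (length x) (fun _ => reg (input_config x a) (length x)) (input_config x a) =
  input_config x a.
Proof.
  intros Hx; etransitivity; [|apply (overlay_reg (length x))].
  apply overlay_ext; trivial; intros i; unfold splice.
  destruct (Nat.leb_spec i (length x)); trivial.
  now rewrite !reg_input_config by (trivial; lia).
Qed.

Lemma guess_tail_input_config {A : structure} (x ys : list (U A)) a :
  x <> [] -> guess_tail (length x) ys (input_config x a) = init_config x ys (last x a).
Proof.
  intros Hx; rewrite <- (overlay_reg (length x) (init_config x ys (last x a))).
  apply overlay_ext; trivial; intros i; unfold splice.
  destruct (Nat.leb_spec i (length x)) as [Hi|Hi].
  - simpl; rewrite app_nil_r, app_nth1; trivial.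
    destruct x; [congruence|simpl in *; lia].
  - rewrite reg_input_config by (trivial; lia); simpl.
    rewrite app_nth2 by lia; f_equal; lia.
Qed.

Lemma init_config_snoc {A : structure} (x ys : list (U A)) b :
  init_config x (ys ++ [b]) b = init_config x ys b.
Proof.
  unfold init_config; f_equal; apply functional_extensionality; intros i.
  rewrite app_assoc; destruct (Nat.lt_ge_cases (pred i) (length (x ++ ys))) as [Hi|Hi].
  - now rewrite app_nth1.
  - rewrite app_nth2, nth_overflow with (l := x ++ ys) by lia.
    now destruct (pred i - length (x ++ ys)) as [|[|]].
Qed.

Lemma halts_det_iff {A : structure} (M : machine A) x :
  halts_det (Uinf A) M x <->
  exists a r, x = a :: r /\ exists n, halts_in M n (input_config x a).
Proof.
  split.
  - intros (a & r & e & Hx & He); exists a, r; split; [exact Hx|].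
    apply (halts_in_reach _ (step_Uinf_iff M)); now exists e.
  - intros (a & r & Hx & He); apply (halts_in_reach _ (step_Uinf_iff M)) in He as [e He].
    now exists a, r, e.
Qed.

Lemma halts_det_padded_iff {A : structure} (M : machine A) x :
  halts_det (Uinf A) M x <->
  exists a r, x = a :: r /\ exists n, halts_padded M n (length x) (input_config x a).
Proof.
  rewrite halts_det_iff; unfold halts_padded.
  split; intros (a & r & Hx & n & Hn); exists a, r; split; trivial; exists n;
    rewrite overlay_input_config in *; trivial; rewrite Hx; discriminate.
Qed.

Lemma halts_ND_iff {A : structure} (M : machine A) x :
  no_oracle M ->
  (halts_ND M x <->
   exists a r, x = a :: r /\ exists n, halts_guessing M n (length x) (input_config x a)).
Proof.
  intros Ho.
  assert (Hstep : forall c c',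
    step (fun _ => False) M c c' <-> exists y, answered_step M y c c').
  { intros c c'; split; [intros Hs; exists (reg c 0)|intros [y Hs]];
      eapply answered_step_no_oracle; eassumption. }
  split.
  - intros (a & r & ys & e & -> & _ & He); exists a, r; split; trivial.
    destruct (proj2 (halts_in_reach _ Hstep) (ex_intro _ e He)) as [n Hn].
    exists n, ys; now rewrite guess_tail_input_config.
  - intros (a & r & -> & n & ys & Hn).
    rewrite guess_tail_input_config, <- init_config_snoc in Hn by discriminate.
    destruct (proj1 (halts_in_reach _ Hstep) (ex_intro _ n Hn)) as [e He].
    exists a, r, (ys ++ [last (a :: r) a]), e; repeat split; try apply He.
    now destruct ys.
Qed.

(** * From oracle machines to guessing machines *)

(* The guess above the frontier is replaced by the content of the frontier
   register, which the simulated machine has not written yet: the last input entry. *)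
Definition advance_pad {A : structure} (k : nat) : list (instr A) :=
  [ICopy (above k) (frontier k); IIdxInc (frontier k); IIdxInc (above k)].

Section OracleToGuess.
Variables (A : structure) (M : machine A) (B : nat).
Hypothesis wfM : wf_machine M.
Hypothesis zregM : Forall (zreg_le B) (prog M).

Let k := nidx M.
Let M' := compile M B (advance_pad k).

Lemma compile_pad_wf : wf_machine M'.
Proof.
  apply compile_wf; trivial; unfold advance_pad.
  - rewrite !Forall_cons_iff; simpl; unfold ireg_ok, above, frontier; simpl nidx; fold k.
    intuition (auto; lia).
  - rewrite !Forall_cons_iff; unfold nonstop; simpl; intuition.
Qed.

Lemma compile_pad_no_oracle : no_oracle M'.
Proof. apply compile_no_oracle; unfold advance_pad; simpl; intuition discriminate. Qed.

Lemma halts_guessing_advance h c c' :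
  1 <= h -> tracks k B h c c' -> code_at M' (lab c') (advance_pad k) ->
  exists d : U A -> config A,
    (forall y, tracks k B (S h) (set_reg c (S h) (reg c h)) (d y) /\
       reg (d y) (S (S h)) = y /\ lab (d y) = lab c' + length (@advance_pad A k)) /\
    forall n, halts_guessing M' n (S h) c' <->
      exists m y, n = length (@advance_pad A k) + m /\ halts_guessing M' m (S (S h)) (d y).
Proof.
  intros _ Ht Hcode; destruct (code_at_cons Hcode) as [Hcopy Hincs].
  pose (f := fun y => fupd (reg c') (S (S h)) y).
  pose (c1 := fun y => mkConfig (S (lab c')) (idx c') (fupd (f y) (S h) (f y h))).
  pose (d := fun y => mkConfig (2 + lab (c1 y)) (advance_idx k h (idx c')) (reg (c1 y))).
  assert (Hd : forall y, nsteps (quiet_step M' (S (S h))) 3 (set_reg c' (S (S h)) y) (d y)).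
  { intros y; apply nsteps_S with (c1 y).
    - apply (quiet_copy (c := set_reg c' (S (S h)) y) Hcopy
        (tracks_above Ht) (tracks_frontier Ht)); lia.
    - exact (quiet_advance_idx (c := c1 y) (S (S h))
        (tracks_frontier Ht) (tracks_above Ht) Hincs). }
  exists d; split.
  - intros y; split; [|split; [|simpl; lia]].
    + apply tracks_advance; trivial.
      * intros j Hj; simpl; unfold f; now rewrite !fupd_neq by lia.
      * simpl; rewrite fupd_eq; unfold f; rewrite fupd_neq by lia.
        now apply (tracks_reg Ht).
    + simpl; unfold f; now rewrite fupd_neq, fupd_eq by lia.
  - intros n; rewrite halts_guessing_guess.
    assert (Hrun : forall y, halts_guessing M' n (S (S h)) (set_reg c' (S (S h)) y) <->
      exists m, n = 3 + m /\ halts_guessing M' m (S (S h)) (d y)).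
    { intros y; apply (nsteps_countdown (R := quiet_step M' (S (S h)))
        (P := fun n => halts_guessing M' n (S (S h)))); [|apply Hd].
      intros; apply halts_guessing_quiet_step; [apply compile_pad_wf|assumption]. }
    split.
    + intros [y Hy]; apply Hrun in Hy as [m Hm]; now exists m, y.
    + intros (m & y & Hm); exists y; apply Hrun; now exists m.
Qed.

Lemma halts_det_compile_pad x : halts_det (Uinf A) M x <-> halts_ND M' x.
Proof.
  rewrite halts_det_padded_iff, (halts_ND_iff _ compile_pad_no_oracle).
  assert (Hsim : forall a r y, x = a :: r -> let c := input_config x a in
    (exists n, halts_padded M n (length x) c) <->
    exists n, halts_guessing M' n (S (length x)) (set_reg c (S (length x)) y)).
  { intros a r y Hx; apply (compile_halts (advance := advance_pad k)
      (source_halts := halts_padded M)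
      (target_halts := fun n h => halts_guessing M' n (S h))
      (fill := fun h _ c => reg c h) wfM zregM); trivial.
    - reflexivity.
    - intros n h c; rewrite halts_padded_pad.
      split; [exists (reg c 0)|intros [_ ?]]; assumption.
    - intros n h c; apply halts_padded_step.
    - intros h c Hc; now exists [].
    - intros n h c d; apply halts_guessing_quiet_step, compile_pad_wf.
    - exact halts_guessing_advance.
    - rewrite Hx; simpl; lia.
    - intros i Hi; apply fupd_neq; lia. }
  split; intros (a & r & Hx & Hn); exists a, r; split; trivial.
  - apply (Hsim a r a Hx) in Hn as [n Hn].
    exists n; apply halts_guessing_guess; now exists a.
  - destruct Hn as [n Hn]; apply halts_guessing_guess in Hn as [y Hn].
    apply (Hsim a r y Hx); now exists n.
Qed.

End OracleToGuess.

(** * From guessing machines to oracle machines *)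

(* [IOracle] writes to a fixed register, so [Z_1], saved above the frontier
   meanwhile, receives the answer and passes it on. *)
Definition advance_query {A : structure} (k : nat) : list (instr A) :=
  [IIdxInc (frontier k); IIdxInc (above k); ICopy (above k) (pointer k 1); IOracle 1;
   ICopy (frontier k) (pointer k 1); ICopy (pointer k 1) (above k);
   ICopy (above k) (frontier k)].

Definition query_regs {T : Type} (h : nat) (y : T) (f : nat -> T) : nat -> T :=
  let f1 := fupd (fupd f (S (S h)) (f 1)) 1 y in
  let f2 := fupd f1 (S h) (f1 1) in
  let f3 := fupd f2 1 (f2 (S (S h))) in
  fupd f3 (S (S h)) (f3 (S h)).

Lemma query_regs_le {T : Type} h (y : T) f i :
  1 <= h -> i <= h -> query_regs h y f i = f i.
Proof.
  intros Hh Hi; unfold query_regs; rewrite fupd_neq by lia.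
  destruct (Nat.eq_dec i 1) as [->|Hi1].
  - now rewrite fupd_eq, !fupd_neq, fupd_eq by lia.
  - now rewrite !fupd_neq by lia.
Qed.

Lemma query_regs_frontier {T : Type} h (y : T) f : 1 <= h -> query_regs h y f (S h) = y.
Proof.
  intros Hh; unfold query_regs.
  now rewrite fupd_neq, fupd_neq, fupd_eq, fupd_eq by lia.
Qed.

Lemma query_regs_above {T : Type} h (y : T) f : 1 <= h -> query_regs h y f (S (S h)) = y.
Proof.
  intros Hh; unfold query_regs; rewrite fupd_eq.
  now rewrite fupd_neq, fupd_eq, fupd_eq by lia.
Qed.

Section GuessToOracle.
Variables (A : structure) (M : machine A) (B : nat).
Hypothesis wfM : wf_machine M.
Hypothesis no_oracleM : no_oracle M.
Hypothesis B_pos : 1 <= B.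
Hypothesis zregM : Forall (zreg_le B) (prog M).

Let k := nidx M.
Let M' := compile M B (advance_query k).

Lemma compile_query_wf : wf_machine M'.
Proof.
  apply compile_wf; trivial; unfold advance_query.
  - rewrite !Forall_cons_iff; simpl; unfold ireg_ok, zreg_ok, pointer, above, frontier.
    simpl nidx; fold k; intuition (auto; lia).
  - rewrite !Forall_cons_iff; unfold nonstop; simpl; intuition.
Qed.

Lemma advance_query_run n h c :
  1 <= h -> idx c (frontier k) = h -> idx c (above k) = S h -> idx c (pointer k 1) = 1 ->
  code_at M' (lab c) (advance_query k) ->
  (halts_in M' n c <-> exists m y, n = 7 + m /\
     halts_in M' m
       (mkConfig (7 + lab c) (advance_idx k h (idx c)) (query_regs h y (reg c)))).
Proof.
  intros Hh Hf Ha Hp Hcode.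
  pose (l := lab c); pose (i := advance_idx k h (idx c)).
  assert (If : i (frontier k) = S h) by apply advance_idx_frontier.
  assert (Ia : i (above k) = S (S h)) by apply advance_idx_above.
  assert (Ip : i (pointer k 1) = 1) by (unfold i; now rewrite advance_idx_pointer).
  pose (f0 := fupd (reg c) (S (S h)) (reg c 1)).
  pose (f1 := fun y => fupd f0 1 y).
  pose (f2 := fun y => fupd (f1 y) (S h) (f1 y 1)).
  pose (f3 := fun y => fupd (f2 y) 1 (f2 y (S (S h)))).
  pose proof (quiet_advance_idx (S (S h)) Hf Ha Hcode) as Hincs.
  apply (@code_at_app _ _ _ [_; _]) in Hcode as [_ Hcode].
  apply code_at_cons in Hcode as [Hsave Hcode].
  apply code_at_cons in Hcode as [Hquery Hcode].
  apply code_at_cons in Hcode as [Hstore Hcode].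
  apply code_at_cons in Hcode as [Hrestore Hcode].
  apply code_at_cons in Hcode as [Hlabel _].
  rewrite Nat.add_comm in Hsave, Hquery, Hstore, Hrestore, Hlabel.
  assert (Hbefore : nsteps (quiet_step M' (S (S h))) 3 c (mkConfig (3 + l) i f0)).
  { apply (nsteps_trans Hincs); eapply nsteps_S; [|apply nsteps_0].
    apply (quiet_copy (c := mkConfig (2 + l) i (reg c)) Hsave Ia Ip); lia. }
  assert (Hafter : forall y, nsteps (quiet_step M' (S (S h))) 3
    (mkConfig (4 + l) i (f1 y)) (mkConfig (7 + l) i (query_regs h y (reg c)))).
  { intros y; eapply nsteps_S.
    { apply (quiet_copy (c := mkConfig (4 + l) i (f1 y)) Hstore If Ip); lia. }
    eapply nsteps_S.
    { apply (quiet_copy (c := mkConfig (5 + l) i (f2 y)) Hrestore Ip Ia); lia. }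
    eapply nsteps_S; [|apply nsteps_0].
    apply (quiet_copy (c := mkConfig (6 + l) i (f3 y)) Hlabel Ia If); lia. }
  pose proof (nsteps_countdown (fun n c d =>
    halts_in_quiet_step (h := S (S h)) (c := c) (d := d) n compile_query_wf)) as Hcount.
  pose proof (fun n =>
    halts_in_answer (c := mkConfig (3 + l) i f0) n compile_query_wf Hquery) as Hanswer.
  rewrite (Hcount _ _ _ _ Hbefore); split.
  - intros (n1 & -> & Hn1); apply Hanswer in Hn1 as (n2 & y & -> & Hn2).
    apply (Hcount _ _ _ _ (Hafter y)) in Hn2 as (m & -> & Hm); now exists m, y.
  - intros (m & y & -> & Hm); exists (4 + m); split; trivial; apply Hanswer.
    exists (3 + m), y; split; trivial; apply (Hcount _ _ _ _ (Hafter y)); now exists m.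
Qed.

Lemma halts_in_advance h c c' :
  1 <= h -> tracks k B h c c' -> code_at M' (lab c') (advance_query k) ->
  exists d : U A -> config A,
    (forall y, tracks k B (S h) (set_reg c (S h) y) (d y) /\
       reg (d y) (S (S h)) = y /\ lab (d y) = lab c' + length (@advance_query A k)) /\
    forall n, halts_in M' n c' <->
      exists m y, n = length (@advance_query A k) + m /\ halts_in M' m (d y).
Proof.
  intros Hh Ht Hcode.
  exists (fun y =>
    mkConfig (7 + lab c') (advance_idx k h (idx c')) (query_regs h y (reg c'))).
  split.
  - intros y; split; [|split; [now apply query_regs_above|simpl; lia]].
    apply tracks_advance; trivial.
    + intros i Hi; now apply query_regs_le.
    + now apply query_regs_frontier.
  - intros n; apply advance_query_run; trivial; [apply Ht|apply Ht|].
    now apply (tracks_pointer Ht).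
Qed.

Lemma halts_ND_compile_query x : halts_ND M x <-> halts_det (Uinf A) M' x.
Proof.
  rewrite halts_det_iff, (halts_ND_iff _ no_oracleM).
  assert (Hsim : forall a r, x = a :: r -> let c := input_config x a in
    (exists n, halts_guessing M n (length x) c) <-> exists n, halts_in M' n c).
  { intros a r Hx; apply (compile_halts (advance := advance_query k)
      (source_halts := halts_guessing M) (target_halts := fun n _ => halts_in M' n)
      (fill := fun _ y _ => y) wfM zregM); trivial.
    - intros h c; split; [now intros [ys ?]|now exists []].
    - intros n h c; apply halts_guessing_guess.
    - intros n h c Hl; rewrite halts_guessing_guess.
      split.
      + intros [y Hn]; apply halts_guessing_step in Hn as (z & c' & Hs & Hn).
        * exists y, c'; split; [|exact Hn].
          apply (answered_step_no_oracle (Uinf A)) in Hs; trivial.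
          now apply (answered_step_no_oracle (Uinf A)).
        * now apply (local_at_mono (c := c) (Nat.le_succ_diag_r h)).
      + intros (y & c' & Hs & Hn); exists y; apply halts_guessing_step; [|now exists y, c'].
        now apply (local_at_mono (c := c) (Nat.le_succ_diag_r h)).
    - intros n h c d; apply halts_in_quiet_step, compile_query_wf.
    - exact halts_in_advance.
    - rewrite Hx; simpl; lia. }
  split; intros (a & r & Hx & Hn); exists a, r; split; trivial; now apply (Hsim a r Hx).
Qed.

End GuessToOracle.

Theorem mainTheorem2 (A : structure) (P : list (U A) -> Prop) :
  SDEC_nu A (Uinf A) P <-> SDEC_ND A P.
Proof.
  split; intros (M & wfM & HP); destruct (zreg_bounded (prog M)) as (B & HB & HM).
  - exists (compile M B (advance_pad (nidx M))).
    split; [now apply compile_pad_wf|split; [apply compile_pad_no_oracle|]].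
    intros x; rewrite HP; now apply halts_det_compile_pad.
  - destruct HP as [Ho HP]; exists (compile M B (advance_query (nidx M))).
    split; [now apply compile_query_wf|].
    intros x; rewrite HP; now apply halts_ND_compile_query.
Qed.
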